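(* Let $r,s,t$ be three integers with $r\leq 2(s-r)^3-\binom{s-r}{2}$ and $t\geq 47$, and let $k$ be a positive integer. Let $G_1$ be a graph of order $s$, and suppose there is an integer $a\geq 1$ and graphs $G_1,G_2,\ldots,G_a$ such that for each $2\leq i\leq a$ the graph $G_i$ is obtained from $G_{i-1}$ by deleting all leaves of $G_{i-1}$, and such that $G_a$ is a complete graph. If the total number of edges deleted in passing from $G_1$ to $G_a$ is $r$, then $$\operatorname{gr}_k(G_1,K_t)\leq 2^{kt}(s-r)^{3kt}.$$
   Context: The order of a graph is its number of vertices; a leaf is a vertex of degree one. A $k$-edge-coloring of $K_n$ assigns to each edge one of $k$ colors (not all colors need be used, and it need not be proper). A subgraph is rainbow if all its edges have distinct colors, and monochromatic if all its edges have the same color. For graphs $G,H$ and a positive integer $k$, the Gallai-Ramsey number $\operatorname{gr}_k(G,H)$ is the minimum integer $n$ such that every $k$-edge-coloring of the complete graph $K_n$ contains a rainbow copy of $G$ or a monochromatic copy of $H$. *)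

(* Defs.v *)
From mathcomp Require Import all_boot.

Set Implicit Arguments.
Unset Strict Implicit.
Unset Printing Implicit Defensive.

Record sgraph := SGraph {
  vertex :> finType;
  adj : rel vertex;
  adj_sym : symmetric adj;
  adj_irr : irreflexive adj }.

Definition edges (G : sgraph) : {set {set G}} :=
  [set [set p.1; p.2] | p : G * G & adj p.1 p.2].

Definition leaf (G : sgraph) (v : G) : bool := #|[set w | adj v w]| == 1.

Section Induced.
Variables (G : sgraph) (P : pred G).

Definition induced_rel : rel {x : G | P x} := fun x y => adj (val x) (val y).

Fact induced_sym : symmetric induced_rel.
Proof. by move=> x y; rewrite /induced_rel adj_sym. Qed.

Fact induced_irr : irreflexive induced_rel.
Proof. by move=> x; rewrite /induced_rel adj_irr. Qed.

Definition induced : sgraph := SGraph induced_sym induced_irr.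
End Induced.

Definition delete_leaves (G : sgraph) : sgraph :=
  induced (fun v : G => ~~ leaf v).

(* Indexed from 1: [peel G 1] is [G] itself. *)
Definition peel (G : sgraph) (i : nat) : sgraph := iter i.-1 delete_leaves G.

Definition is_complete (G : sgraph) : Prop :=
  forall x y : G, x != y -> adj x y.

Section Complete.
Variable t : nat.

Definition neq_rel : rel 'I_t := fun x y => x != y.

Fact neq_rel_sym : symmetric neq_rel.
Proof. by move=> x y; rewrite /neq_rel eq_sym. Qed.

Fact neq_rel_irr : irreflexive neq_rel.
Proof. by move=> x; rewrite /neq_rel eqxx. Qed.

Definition complete_graph : sgraph := SGraph neq_rel_sym neq_rel_irr.
End Complete.

(* A k-edge-coloring of K_n is given on all subsets of its vertex set 'I_n,
   but only its values on two-element subsets, the edges of K_n, are used.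
   For k > 0 every edge-coloring arises in this way. *)
Definition coloring (k n : nat) := {ffun {set 'I_n} -> 'I_k}.

Section Copies.
Variables (k n : nat) (c : coloring k n).

(* A copy of G in K_n is an injection of the vertices of G into 'I_n;
   it maps the edge e of G to the edge [f @: e] of K_n. *)
Definition rainbow_copy (G : sgraph) (f : {ffun G -> 'I_n}) : bool :=
  injectiveb f &&
  [forall e1 in edges G, forall e2 in edges G,
     (e1 != e2) ==> (c (f @: e1) != c (f @: e2))].

Definition mono_copy (H : sgraph) (f : {ffun H -> 'I_n}) : bool :=
  injectiveb f &&
  [forall e1 in edges H, forall e2 in edges H, c (f @: e1) == c (f @: e2)].
End Copies.

Definition gr_property (k : nat) (G H : sgraph) (n : nat) : bool :=
  [forall c : coloring k n,
     [exists f : {ffun G -> 'I_n}, rainbow_copy c f]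
  || [exists f : {ffun H -> 'I_n}, mono_copy c f]].

Lemma ramsey (k N : nat) : exists b : nat,
  forall (t : {ffun 'I_k -> nat}) (n : nat) (c : coloring k n) (S : {set 'I_n}),
  \sum_i t i <= N -> b <= #|S| ->
  exists i : 'I_k, exists2 A : {set 'I_n}, A \subset S /\ #|A| = t i &
    forall x y, x \in A -> y \in A -> x != y -> c [set x; y] = i.
Proof.
elim: N => [|N [b IHN]].
  exists 0 => t n c S; rewrite leqn0 sum_nat_eq0 => /forallP/= t0 _.
  exists (c set0), set0; last by move=> x y; rewrite inE.
  by rewrite sub0set cards0 (eqP (t0 _)).
exists (k * b).+1 => t n c S le_tN /[dup] lt_bS /(leq_ltn_trans (leq0n _)).
case: (pickP (fun i => t i == 0)) => [i /eqP ti0 _ | t_gt0].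
  by exists i, set0; rewrite ?sub0set ?cards0 ?ti0 // => x y; rewrite inE.
case/card_gt0P=> x Sx.
pose B i := [set y in S :\ x | c [set x; y] == i].
have [i le_bB | lt_Bb] := pickP (fun i => b <= #|B i|); last first.
  have: k * b < k * b; last by rewrite ltnn.
  move: lt_bS; rewrite (cardsD1 x) Sx add1n ltnS => lt_bS.
  have b_gt0: 0 < b.
    by move: (lt_Bb (c set0)); case: (b).
  have k_gt0: 0 < k by case: (c set0) => m; apply: leq_ltn_trans.
  apply: leq_ltn_trans lt_bS _.
  rewrite -sum1_card (partition_big (fun y => c [set x; y]) xpredT) //=.
  apply: leq_ltn_trans (_ : \sum_(i < k) b.-1 < _).
    apply: leq_sum => i _; rewrite -ltnS prednK // ltnNge sum1dep_card.
    by rewrite -/(B i) lt_Bb.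
  by rewrite sum_nat_const card_ord ltn_pmul2l // prednK.
pose u := [ffun j => t j - (j == i)].
have le_uN: \sum_j u j <= N.
  rewrite -ltnS; apply: leq_trans le_tN.
  rewrite [ltnRHS](bigD1 i) //= (bigD1 i) //= ffunE eqxx subn1.
  rewrite (eq_bigr t) => [|j /negPf ji]; last by rewrite ffunE ji subn0.
  by rewrite -addSn prednK // lt0n t_gt0.
have [j [A [sAB cardA] monoA]] := IHN u n c (B i) le_uN le_bB.
have sBS: B i \subset S by apply/subsetP=> y; rewrite !inE => /andP[/andP[]].
have [eq_ji | ne_ji] := eqVneq j i; last first.
  exists j, A => //; split; first exact: subset_trans sAB sBS.
  by rewrite cardA ffunE (negPf ne_ji) subn0.
have A'x: x \notin A.
  by apply: contraTN sAB => Ax; apply/subsetPn; exists x; rewrite ?inE ?eqxx.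
have xA y: y \in A -> c [set x; y] = i.
  by move/(subsetP sAB); rewrite inE => /andP[_ /eqP].
exists i, (x |: A).
  split; first by rewrite subUset sub1set Sx (subset_trans sAB).
  by rewrite cardsU1 A'x cardA eq_ji ffunE eqxx subnKC // lt0n t_gt0.
move=> y z /setU1P[-> | Ay] /setU1P[-> | Az] ne_yz; first by rewrite eqxx in ne_yz.
- exact: xA.
- by rewrite setUC xA.
- by rewrite monoA.
Qed.

Lemma gr_property_exists (k : nat) (G H : sgraph) :
  exists n, gr_property k G H n.
Proof.
have [n ramsey_n] := ramsey k (\sum_(i < k) #|H|).
exists n; apply/forallP=> c; apply/orP; right.
have [||i [A [_ cardA] monoA]] :=
  ramsey_n [ffun=> #|H|] n c setT; last 1 first.
- rewrite ffunE in cardA.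
  pose f := [ffun v : H => enum_val (cast_ord (esym cardA) (enum_rank v))].
  have f_inj: injective f.
    move=> u v; rewrite !ffunE.
    by move/enum_val_inj/cast_ord_inj/enum_rank_inj.
  have fA v: f v \in A by rewrite ffunE enum_valP.
  have mono_i e: e \in edges H -> c (f @: e) = i.
    case/imsetP=> -[u v] /=; rewrite inE /= => Huv ->.
    rewrite imsetU1 imset_set1 monoA // inj_eq //.
    by apply: contraTneq Huv => ->; rewrite adj_irr.
  apply/existsP; exists f; apply/andP; split; first exact/injectiveP.
  apply/forall_inP=> e1 He1; apply/forall_inP=> e2 He2.
  by rewrite !mono_i.
- by under eq_bigr do rewrite ffunE.
- by rewrite cardsT card_ord.
Qed.

Definition gallai_ramsey (k : nat) (G H : sgraph) : nat :=
  ex_minn (gr_property_exists k G H).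

(* Main.v *)
(** Put [d = s - r] and [D = 2 * d ^ 3]. If every large enough set [X] of
    vertices of [K_n] contains a vertex with at least [#|X| / D] neighbours in
    [X] along one color, then passing repeatedly to such neighbourhoods produces
    a monochromatic [K_t] as in the usual proof of Ramsey's theorem. Otherwise
    some set [X] with at least [D ^ 2] elements has all its color degrees
    smaller than [#|X| / D], and [G_1] is embedded greedily in [X] as a rainbow
    graph. First come the at most [d] vertices of [G_a]: the only danger is a
    vertex joined by the same color to two vertices chosen before, and double
    counting lets each new vertex be chosen so that few vertices of this kind
    arise. Then the leaves are put back one at a time; a leaf only has to avoid
    the colors already used, fewer than [D] of them, at a single vertex. *)
Require Import Defs.
From mathcomp Require Import all_boot.
From mathcomp Require Import zify.

Set Implicit Arguments.
Unset Strict Implicit.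
Unset Printing Implicit Defensive.

(** * Unions and edge sets *)

Lemma leq_card_bigcup (I T : finType) (A : {pred I}) (B : I -> {set T}) :
  #|\bigcup_(i in A) B i| <= \sum_(i in A) #|B i|.
Proof.
elim/big_rec2: _ => [|i m X _ le_Xm]; first by rewrite cards0.
by apply: leq_trans (leq_add (leqnn _) le_Xm); rewrite cardsU leq_subr.
Qed.

Lemma edgesP (G : sgraph) (e : {set G}) :
  reflect (exists u v, adj u v /\ e = [set u; v]) (e \in edges G).
Proof.
apply: (iffP imsetP) => [[[u v]] | [u [v [uv ->]]]].
  by rewrite inE /= => uv ->; exists u, v.
by exists (u, v); rewrite ?inE.
Qed.

Lemma cards_edge (G : sgraph) (e : {set G}) : e \in edges G -> #|e| = 2.
Proof.
case/edgesP=> u [v [uv ->]]; rewrite cards2.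
by case: eqVneq uv => // ->; rewrite adj_irr.
Qed.

Definition edges_in (G : sgraph) (P : {set G}) : {set {set G}} :=
  [set e in edges G | e \subset P].

Lemma card_edges_in (G : sgraph) (P : {set G}) : #|edges_in P| <= 'C(#|P|, 2).
Proof.
rewrite -cards_draws; apply/subset_leq_card/subsetP=> e; rewrite !inE.
by case/andP=> /cards_edge-> ->.
Qed.

Lemma edges_in_setU1 (G : sgraph) (P : {set G}) v e :
  e \in edges_in (v |: P) ->
  e \in edges_in P \/ exists u, [/\ u \in P, adj u v & e = [set u; v]].
Proof.
rewrite !inE => /andP[Ee]; rewrite Ee; case/edgesP: Ee => x [y [xy ->]].
rewrite subUset !sub1set !inE.
case: (eqVneq x v) xy => [->|_] xy; case: (eqVneq y v) xy => [->|_] xy /=.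
- by rewrite adj_irr in xy.
- by move=> Py; right; exists y; rewrite adj_sym setUC.
- by rewrite andbT => Px; right; exists x.
- by case/andP=> Px Py; left; rewrite subUset !sub1set Px.
Qed.

(** * Greedy extension of partial rainbow embeddings *)

Section Greedy.
Variables (k n : nat) (c : coloring k n) (S : {set 'I_n}).

Definition nbrs (x : 'I_n) (i : 'I_k) : {set 'I_n} :=
  [set y in S | (y != x) && (c [set x; y] == i)].

Section Embedding.
Variable G : sgraph.
Implicit Types (P : {set G}) (f : G -> 'I_n).

(** A partial embedding is a total function of which only the values on [P] matter, so that adding a
    vertex is a mere update by [extend]. *)
Definition rainbow_on P f :=
  [/\ f @: P \subset S, {in P &, injective f} &
      {in edges_in P &, injective (fun e : {set G} => c (f @: e))}].

Definition colors P f : {set 'I_k} :=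
  [set c (f @: e) | e : {set G} in edges_in P].

Definition extend f v w : G -> 'I_n := fun x => if x == v then w else f x.

Lemma extend_in P f v w x : v \notin P -> x \in P -> extend f v w x = f x.
Proof. by rewrite /extend => P'v Px; case: eqP Px P'v => // -> ->. Qed.

(** All new edges join [v] to [P]. The first color condition separates them from the old edges, the
    second from each other. *)
Lemma rainbow_extend P f v w :
    rainbow_on P f -> v \notin P -> w \in S -> w \notin f @: P ->
    {in P, forall u, adj u v -> c [set f u; w] \notin colors P f} ->
    {in P &, forall u u', adj u v -> adj u' v ->
       c [set f u; w] = c [set f u'; w] -> u = u'} ->
  rainbow_on (v |: P) (extend f v w).
Proof.
move=> [fS f_inj f_rb] P'v Sw fP'w newc newd.
have fv: extend f v w v = w by rewrite /extend eqxx.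
have fP := extend_in f w P'v.
have fim (A : {set G}) : A \subset P -> extend f v w @: A = f @: A.
  by move/subsetP=> sAP; apply: eq_in_imset => x /sAP/fP.
have fe u: u \in P -> extend f v w @: [set u; v] = [set f u; w].
  by move=> Pu; rewrite imsetU1 imset_set1 fv fP.
have colP e : e \in edges_in P -> c (extend f v w @: e) \in colors P f.
  move=> Pe; have: e \subset P by move: Pe; rewrite inE => /andP[].
  by move/fim->; apply/imsetP; exists e.
split.
- by rewrite imsetU1 fv subUset sub1set Sw fim.
- move=> x y /setU1P[->|Px] /setU1P[->|Py] //; rewrite ?fv ?fP //.
  + by move=> Dw; rewrite Dw imset_f in fP'w.
  + by move=> Dw; rewrite -Dw imset_f in fP'w.
  + exact: f_inj.
- move=> e1 e2 /edges_in_setU1[Pe1 | [u [Pu uv ->]]].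
    move=> /edges_in_setU1[Pe2 | [u [Pu uv ->]]].
      have [s1 s2]: e1 \subset P /\ e2 \subset P.
        by move: Pe1 Pe2; rewrite !inE => /andP[_ ->] /andP[_ ->].
      by rewrite !fim //; apply: f_rb.
    by move=> eqc; case/negP: (newc u Pu uv); rewrite -fe // -eqc colP.
  move=> /edges_in_setU1[Pe2 | [u' [Pu' u'v ->]]].
    by move=> eqc; case/negP: (newc u Pu uv); rewrite -fe // eqc colP.
  by rewrite !fe // => /newd->.
Qed.

Variable m : nat.
Hypothesis nbrs_le : forall x i, x \in S -> #|nbrs x i| <= m.

(** These are the choices of a new vertex that repeat a used color on an edge to the image of
    [U]. *)
Definition recolored (U P : {set G}) f : {set 'I_n} :=
  \bigcup_(u in U) \bigcup_(i in colors P f) nbrs (f u) i.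

Lemma card_recolored (U P : {set G}) f :
  rainbow_on P f -> U \subset P ->
  #|recolored U P f| <= #|U| * (#|edges_in P| * m).
Proof.
move=> [/subsetP fS _ _] /subsetP sUP.
apply: leq_trans (leq_card_bigcup _ _) _; rewrite -sum_nat_const.
apply: leq_sum => u Uu; apply: leq_trans (leq_card_bigcup _ _) _.
apply: (@leq_trans (\sum_(i in colors P f) m)).
  by apply: leq_sum => i _; apply: nbrs_le; rewrite fS ?imset_f ?sUP.
by rewrite sum_nat_const leq_mul2r leq_imset_card orbT.
Qed.

Lemma notin_recolored (U P : {set G}) f u w :
  u \in U -> w \in S -> w != f u -> w \notin recolored U P f ->
  c [set f u; w] \notin colors P f.
Proof.
move=> Uu Sw ne_w; apply: contra => cP.
apply/bigcupP; exists u => //; apply/bigcupP; exists (c [set f u; w]) => //.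
by rewrite inE Sw ne_w eqxx.
Qed.

(** With at most one neighbor in [P], no two new edges can clash, so only the image of [P] and the
    colors already used have to be avoided. *)
Lemma rainbow_add_leaf P f v :
    rainbow_on P f -> v \notin P ->
    #|[set u in P | adj u v]| <= 1 -> #|P| + #|edges G|.-1 * m < #|S| ->
  exists g, rainbow_on (v |: P) g.
Proof.
set U := [set _ in _ | _] => rb P'v leU ltS.
have sUP: U \subset P by apply/subsetP=> u; rewrite inE => /andP[].
have le_rec: #|recolored U P f| <= #|edges G|.-1 * m.
  apply: leq_trans (card_recolored rb sUP) _.
  have [->|[u Uu]] := set_0Vmem U; first by rewrite cards0.
  have /andP[Pu uv]: (u \in P) && adj u v by move: Uu; rewrite inE.
  (* This edge is not embedded yet, whence the predecessor in [#|edges G|.-1]. *)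
  have Euv: [set u; v] \in edges G by apply/edgesP; exists u, v.
  rewrite (leq_trans (leq_mul leU (leqnn _))) // mul1n leq_mul2r.
  apply/orP; right; rewrite (cardsD1 [set u; v] (edges G)) Euv /=.
  apply/subset_leq_card/subsetP=> e; rewrite !inE => /andP[-> seP].
  rewrite andbT; apply: contraNneq P'v => De; apply: (subsetP seP).
  by rewrite De !inE eqxx orbT.
have [w Sw]: exists w, w \in S :\: (f @: P :|: recolored U P f).
  apply/card_gt0P; rewrite cardsD subn_gt0.
  apply: leq_ltn_trans ltS.
  apply: leq_trans (subset_leq_card (subsetIr _ _)) _.
  rewrite cardsU; apply: leq_trans (leq_subr _ _) _.
  by rewrite leq_add // leq_imset_card.
move: Sw; rewrite inE in_setU negb_or => /andP[/andP[fP'w rec'w] Sw].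
have ne_w u : u \in P -> w != f u.
  by move=> Pu; apply: contraNneq fP'w => ->; rewrite imset_f.
exists (extend f v w).
apply: rainbow_extend => // [u Pu uv | u u' Pu Pu' uv u'v _].
  by apply: notin_recolored rec'w; rewrite ?ne_w // inE Pu.
by apply: (card_le1_eqP leU); rewrite inE ?Pu ?Pu'.
Qed.

(** A leaf of [G] has at most one neighbor in any set, so the vertices outside [P] can be added one
    at a time in any order. *)
Lemma rainbow_complete P f :
    rainbow_on P f ->
    (forall v, v \notin P -> leaf v) ->
    (#|G|.-1 + #|edges G|.-1 * m < #|S|) ->
  exists g, rainbow_on [set: G] g.
Proof.
have [p] := ubnP #|~: P|; elim: p P f => // p IHp P f ltp rb leafP ltS.
have [P'0 | [v]] := set_0Vmem (~: P).
  by exists f; rewrite -setC0 -P'0 setCK.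
rewrite inE => P'v.
have [||g rb'] := rainbow_add_leaf rb P'v.
- rewrite -(eqP (leafP v P'v)); apply/subset_leq_card/subsetP=> u.
  by rewrite !inE adj_sym => /andP[].
- apply: leq_ltn_trans ltS; rewrite leq_add2r.
  have: #|v |: P| <= #|G| by apply: max_card.
  by rewrite cardsU1 P'v; lia.
apply: IHp rb' _ ltS => [|u]; last by rewrite !inE => /norP[_ /leafP].
by have := cardsC P; have := cardsC (v |: P); rewrite cardsU1 P'v; lia.
Qed.

(** * Double counting and the embedding of small graphs *)

Definition bicolored (x y : 'I_n) : {set 'I_n} :=
  [set w in S | [&& w != x, w != y & c [set x; w] == c [set y; w]]].

(** Once the sums are exchanged, a fixed [w] determines the color [c [set x; w]], and the [y] that
    count are neighbors of [w] in that color, at most [m] of them. *)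
Lemma sum_bicolored x : \sum_(y in S) #|bicolored x y| <= #|S| * m.
Proof.
rewrite -sum_nat_const.
have ->: \sum_(y in S) #|bicolored x y|
       = \sum_(y in S) \sum_(w in S)
           [&& w != x, w != y & c [set x; w] == c [set y; w]].
  apply: eq_bigr => y _; rewrite -sum1_card big_mkcond [RHS]big_mkcond /=.
  by apply: eq_bigr => w _; rewrite inE; case: (w \in S) => //; case: ifP.
rewrite exchange_big /=; apply: leq_sum => w Sw.
apply: leq_trans (nbrs_le (c [set x; w]) Sw).
rewrite -sum1_card big_mkcond [leqRHS]big_mkcond /=; apply: leq_sum => y _.
rewrite inE; case: (y \in S) => //=.
rewrite (eq_sym w y) (setUC [set y]) (eq_sym (c [set x; w])).
by case: (w != x) => //=; case: ifP.
Qed.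

(** All pairs in [P] are tested, whatever the adjacencies in [G], so the set does not depend on
    which vertex is added next. *)
Definition cherries P f : {set 'I_n} :=
  [set w in S | (w \notin f @: P) &&
     [exists x in P, exists y in P,
        (x != y) && (c [set f x; w] == c [set f y; w])]].

Lemma cherries_extend P f v w :
  v \notin P ->
  cherries (v |: P) (extend f v w) \subset
  cherries P f :|: \bigcup_(x in P) bicolored (f x) w.
Proof.
move=> P'v; apply/subsetP=> z; rewrite !inE => /and3P[Sz].
have fP := extend_in f w P'v.
rewrite imsetU1 {1}/extend eqxx (eq_in_imset fP) in_setU1 negb_or.
case/andP=> zw zf /exists_inP[x Px /exists_inP[y Py /andP[ne_xy eqc]]].
have bic u : u \in P -> c [set f u; z] == c [set w; z] ->
  z \in \bigcup_(x in P) bicolored (f x) w.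
- move=> Pu eqc'; apply/bigcupP; exists u => //.
  rewrite inE Sz zw eqc' !andbT /=.
  by apply: contraNneq zf => ->; rewrite imset_f.
have fv: extend f v w v = w by rewrite /extend eqxx.
apply/orP; move: Px Py eqc ne_xy => /setU1P[->|Px] /setU1P[->|Py];
  rewrite ?fv ?fP // => eqc ne_xy.
- by rewrite eqxx in ne_xy.
- by right; apply: (bic y); rewrite // eq_sym.
- by right; apply: (bic x).
left; rewrite Sz zf; apply/exists_inP; exists x => //.
by apply/exists_inP; exists y; rewrite ?ne_xy.
Qed.

(* Averaging the cherries over the new vertex keeps their number at
   [O(j ^ 2 * m)], although those on a single pair can fill [S]. *)
Lemma rainbow_add_vertex P f v (j := #|P|) :
    rainbow_on P f -> #|cherries P f| <= j * j.-1 * m -> v \notin P ->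
    2 * j + j * j.-1 * (j + 2) * m < #|S| ->
  exists g, rainbow_on (v |: P) g /\ #|cherries (v |: P) g| <= j.+1 * j * m.
Proof.
move=> rb leC P'v ltS; have [/subsetP fS _ _] := rb.
pose h w := \sum_(x in P) #|bicolored (f x) w|.
pose H := [set w in S | 2 * (j * m) < h w].
(* Markov's inequality: the average of [h] over [S] is at most [j * m], so at most half of [S]
   exceeds twice that value. *)
have leH: 2 * #|H| <= #|S|.
  have: #|H| * (2 * (j * m)).+1 <= j * m * #|S|.
    rewrite -sum_nat_const; apply: (@leq_trans (\sum_(w in S) h w)).
      rewrite big_mkcond [leqRHS]big_mkcond /=; apply: leq_sum => w _.
      by rewrite inE; case: (w \in S) => //=; case: ifP.
    rewrite exchange_big /= -mulnA (mulnC m) -sum_nat_const.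
    by apply: leq_sum => x _; apply: sum_bicolored.
  by move: (j * m) => X; nia.
have leR: #|recolored P P f| * 2 <= j * (j * j.-1 * m).
  have := card_recolored rb (subxx P); have := card_edges_in P.
  rewrite -/j bin2 => le1 le2.
  have: #|edges_in P| * 2 <= j * j.-1 by lia.
  by move: le2; nia.
(* At least half of [S] lies outside [H], and the other three sets have together at most
   [j + j * j.-1 * m * (1 + j / 2)] elements; the assumed strict lower bound on [#|S|] is twice
   this. *)
have [w Sw]: exists w,
    w \in S :\: (f @: P :|: cherries P f :|: recolored P P f :|: H).
  apply/card_gt0P; rewrite cardsD subn_gt0.
  apply: leq_ltn_trans (subset_leq_card (subsetIr _ _)) _.
  have leU (A B : {set 'I_n}) : #|A :|: B| <= #|A| + #|B| := leq_card_setU A B.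
  have lef: #|f @: P| <= j by apply: leq_imset_card.
  apply: leq_ltn_trans (leq_trans (leU _ _) (leq_add (leU _ _) (leqnn _))) _.
  rewrite -addnA; apply: leq_ltn_trans (leq_add (leU _ _) (leqnn _)) _.
  have Dltm: j * j.-1 * (j + 2) * m = j * (j * j.-1 * m) + 2 * (j * j.-1 * m).
    by rewrite mulnC mulnA (mulnC m) mulnDr mulnC [_ * 2]mulnC.
  move: ltS leC leR lef leH; rewrite Dltm.
  move: (j * j.-1 * m) #|H| #|S| => Y cH cS.
  by move: (j * Y) #|cherries P f| #|recolored P P f| #|f @: P|; lia.
move: Sw; rewrite inE !in_setU !negb_or -!andbA.
case/and5P=> fP'w C'w rec'w H'w Sw.
have ne_w u : u \in P -> w != f u.
  by move=> Pu; apply: contraNneq fP'w => ->; rewrite imset_f.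
exists (extend f v w); split.
  apply: rainbow_extend => // [u Pu uv | u u' Pu Pu' uv u'v /eqP eqc].
    by apply: notin_recolored rec'w; rewrite ?ne_w.
  apply/eqP; apply: contraR C'w => ne_u; rewrite inE Sw fP'w.
  apply/exists_inP; exists u => //; apply/exists_inP; exists u' => //.
  by rewrite ne_u.
apply: leq_trans (subset_leq_card (cherries_extend _ _ P'v)) _.
rewrite cardsU; apply: leq_trans (leq_subr _ _) _.
have := leq_card_bigcup (mem P) (fun x => bicolored (f x) w).
move: H'w; rewrite inE Sw -leqNgt /= /h => le1 le2.
(* Since [w] is not in [H], it creates at most [2 * (j * m)] new cherries, exactly the growth
   allowed by the invariant. *)
have ->: j.+1 * j * m = j * j.-1 * m + 2 * (j * m) by case: (j) => [|i] /=; nia.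
by apply: leq_add leC (leq_trans le2 le1).
Qed.

(** Vertices are added one by one, with the bound [p * p.-1 * m] on the cherries as invariant. *)
Lemma rainbow_small d :
    0 < n -> #|G| <= d -> 2 * d + d ^ 3 * m < #|S| ->
  exists g, rainbow_on [set: G] g.
Proof.
move=> n_gt0 leGd ltS.
suff H p : p <= #|G| -> exists P f,
    [/\ #|P| = p, rainbow_on P f & #|cherries P f| <= p * p.-1 * m].
  have [P [f [cardP rb _]]] := H _ (leqnn _).
  have ->: [set: G] = P; last by exists f.
  by apply/esym/eqP; rewrite eqEcard subsetT cardsT cardP leqnn.
elim: p => [_ | p IHp ltp].
  exists set0, (fun=> Ordinal n_gt0); split; first exact: cards0.
    split=> [|x y|e1 e2]; rewrite ?imset0 ?sub0set ?inE //.
    case/andP=> /cards_edge e1_2; rewrite subset0 => /eqP e1_0.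
    by rewrite e1_0 cards0 in e1_2.
  rewrite (_ : cherries _ _ = set0) ?cards0 //.
  apply/setP=> w; rewrite !inE imset0 inE /=; apply/andP=> -[_].
  by case/exists_inP=> x; rewrite inE.
have [P [f [cardP rb leC]]] := IHp (ltnW ltp).
have [v P'v]: exists v, v \in ~: P.
  by apply/card_gt0P; have := cardsC P; lia.
rewrite inE in P'v.
have [||g [rb' leC']] := rainbow_add_vertex rb _ P'v; rewrite ?cardP //.
  have: p * p.-1 * (p + 2) <= d ^ 3.
    have: p.+1 <= d by lia.
    case: (p) => [|q] //= ltqd.
    apply: leq_trans (_ : q.+2 ^ 3 <= _); last by rewrite leq_exp2r.
    by rewrite !expnS expn0; nia.
  by move: ltS; nia.
by exists (v |: P), g; rewrite cardsU1 P'v cardP; split; rewrite // -cardP.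
Qed.

End Embedding.

(** * Deleting leaves and putting them back *)

Lemma rainbow_delete_leaves (G : sgraph) m :
    (forall x i, x \in S -> #|nbrs x i| <= m) ->
    #|G|.-1 + #|edges G|.-1 * m < #|S| ->
    0 < n ->
    (exists g, rainbow_on [set: delete_leaves G] g) ->
  exists g, rainbow_on [set: G] g.
Proof.
move=> lem ltS n_gt0 [g [gS g_inj g_rb]].
pose P := [set v : G | ~~ leaf v].
(* Leaves get a dummy value, which is overwritten when they are added. *)
pose f (v : G) : 'I_n := oapp g (Ordinal n_gt0) (insub v).
have fval x : f (val x) = g x by rewrite /f valK.
have PE : P = val @: [set: delete_leaves G].
  apply/setP=> v; rewrite inE; apply/idP/imsetP=> [lv | [x _ ->]].
    by exists (Sub v lv); rewrite ?SubK ?inE.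
  exact: (valP x).
have edge_val e : e \in edges_in P ->
    exists2 e' : {set delete_leaves G}, e' \in edges_in [set: delete_leaves G]
      & e = val @: e'.
  rewrite inE => /andP[/edgesP[u [v [uv ->]]]].
  rewrite subUset !sub1set !inE => /andP[Pu Pv].
  pose u' : delete_leaves G := Sub u Pu; pose v' : delete_leaves G := Sub v Pv.
  exists [set u'; v']; last by rewrite imsetU1 imset_set1 !SubK.
  by rewrite !inE subsetT andbT; apply/edgesP; exists u', v'.
have im_val (A : {set delete_leaves G}) : f @: (val @: A) = g @: A.
  by rewrite -imset_comp; apply: eq_imset => x; apply: fval.
apply: (@rainbow_complete G m lem P f) => //; last first.
  by move=> v; rewrite inE negbK.
split.
- by rewrite PE im_val.
- move=> x y; rewrite PE => /imsetP[x' _ ->] /imsetP[y' _ ->].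
  by rewrite !fval => /g_inj->.
- move=> e1 e2 /edge_val[e1' E1 ->] /edge_val[e2' E2 ->].
  by rewrite !im_val => /g_rb->.
Qed.

End Greedy.

(** Every lost edge contains a leaf and a leaf lies on one edge only, so no more edges than vertices
    are lost. Sums replace differences to avoid truncated subtraction. *)
Lemma edges_delete_leaves (G : sgraph) :
  #|edges G| + #|delete_leaves G| <= #|edges (delete_leaves G)| + #|G|
  /\ #|edges (delete_leaves G)| <= #|edges G|.
Proof.
pose P := [set v : G | ~~ leaf v].
have cardG: #|delete_leaves G| = #|P|.
  by rewrite card_sig; apply: eq_card => v; rewrite !inE.
have EP: #|edges (delete_leaves G)| = #|edges_in P|.
  rewrite -(card_imset _ (imset_inj (@val_inj _ _ (delete_leaves G)))).
  apply: eq_card => e; apply/imsetP/idP.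
    case=> e' /edgesP[u [v [uv ->]]] ->; rewrite imsetU1 imset_set1 !inE.
    rewrite subUset !sub1set !inE (valP u) (valP v) !andbT.
    by apply/edgesP; exists (val u), (val v).
  rewrite inE => /andP[/edgesP[u [v [uv ->]]]].
  rewrite subUset !sub1set !inE => /andP[Pu Pv].
  pose u' : delete_leaves G := Sub u Pu; pose v' : delete_leaves G := Sub v Pv.
  exists [set u'; v']; last by rewrite imsetU1 imset_set1 !SubK.
  by apply/edgesP; exists u', v'.
have sE: edges_in P \subset edges G.
  by apply/subsetP=> e; rewrite inE => /andP[].
rewrite cardG EP; split; last exact: subset_leq_card.
suff: #|edges G :\: edges_in P| <= #|~: P|.
  by have := cardsC P; rewrite cardsDS //; lia.
(* On a leaf, [star] is its only edge; the default [v] serves only vertices without neighbors. *)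
pose star (v : G) := [set v; odflt v [pick w | adj v w]].
apply: leq_trans (leq_imset_card star (~: P)).
have leafE v w : leaf v -> adj v w -> star v = [set v; w].
  rewrite /star => /eqP lv vw; congr [set v; _].
  case: pickP => [w' vw' | /(_ w)]; last by rewrite vw.
  by move: (eq_leq lv) => /card_le1_eqP; apply; rewrite inE.
apply/subset_leq_card/subsetP=> e; rewrite !inE => /andP[+ Ee].
rewrite Ee /=; case/edgesP: Ee => u [v [uv ->]].
rewrite subUset !sub1set !inE negb_and !negbK => /orP[lu | lv].
  by rewrite -(leafE u v) // imset_f // !inE negbK.
by rewrite setUC -(leafE v u) 1?adj_sym // imset_f // !inE negbK.
Qed.

Lemma card_delete_leaves (G : sgraph) : #|delete_leaves G| <= #|G|.
Proof. by rewrite card_sig max_card. Qed.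

(** The one-round inequalities telescope. If [r] edges are lost from a graph of order [s], at most
    [s - r] vertices remain. *)
Lemma edges_iter_delete_leaves (G : sgraph) i (H := iter i delete_leaves G) :
  #|edges G| + #|H| <= #|edges H| + #|G| /\ #|H| <= #|G|.
Proof.
rewrite {}/H; elim: i => [|i]; first by rewrite /= !leqnn.
rewrite iterS; move: (iter i _ G) => H.
by have := card_delete_leaves H; have [] := edges_delete_leaves H; lia.
Qed.

(** The threshold for [G] serves every round, because the intermediate graphs have no more vertices
    or edges than [G]. *)
Lemma rainbow_iter_delete_leaves k n (c : coloring k n) (S : {set 'I_n}) m i
    (G : sgraph) :
    (forall x i, x \in S -> #|nbrs c S x i| <= m) ->
    #|G|.-1 + #|edges G|.-1 * m < #|S| ->
    0 < n ->
    (exists g, rainbow_on c S [set: iter i delete_leaves G] g) ->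
  exists g, rainbow_on c S [set: G] g.
Proof.
move=> lem + n_gt0; elim: i G => [|i IHi] G //; rewrite iterSr => ltS rb.
apply: (rainbow_delete_leaves lem ltS n_gt0 (IHi _ _ rb)).
have [_ leE] := edges_delete_leaves G.
have leG := card_delete_leaves G.
by apply: leq_ltn_trans ltS; rewrite leq_add ?leq_mul //; lia.
Qed.

(** * Rainbow copies and monochromatic cliques *)

Lemma rainbow_copyP k n (c : coloring k n) (S : {set 'I_n}) (G : sgraph) g :
  rainbow_on c S [set: G] g -> [exists f : {ffun G -> 'I_n}, rainbow_copy c f].
Proof.
case=> _ g_inj g_rb; apply/existsP; exists (finfun g).
have imE (e : {set G}) : finfun g @: e = g @: e.
  by apply: eq_imset => x; rewrite ffunE.
apply/andP; split; first by apply/injectiveP=> x y; rewrite !ffunE => /g_inj->.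
apply/forall_inP=> e1 E1; apply/forall_inP=> e2 E2; apply/implyP.
by apply: contraNneq; rewrite !imE => /g_rb->; rewrite // inE subsetT andbT.
Qed.

Lemma mono_copyP k n (c : coloring k n) t (A : {set 'I_n}) i :
    t <= #|A| ->
    (forall x y, x \in A -> y \in A -> x != y -> c [set x; y] = i) ->
  [exists f : {ffun complete_graph t -> 'I_n}, mono_copy c f].
Proof.
move=> letA monoA; apply/existsP.
pose f := [ffun v : complete_graph t => enum_val (widen_ord letA v)].
have f_inj : injective f.
  move=> u v; rewrite !ffunE => /enum_val_inj/(congr1 val) /= uv.
  exact: ord_inj uv.
have fi e : e \in edges (complete_graph t) -> c (f @: e) = i.
  case/edgesP=> u [v [uv ->]]; rewrite imsetU1 imset_set1.
  by apply: monoA; rewrite ?(inj_eq f_inj) // ffunE enum_valP.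
exists f; apply/andP; split; first exact/injectiveP.
by apply/forall_inP=> e1 E1; apply/forall_inP=> e2 E2; rewrite !fi.
Qed.

(** Induction on the sum of [u]: passing to a dense neighborhood of [x] in color [i] costs a factor
    [D] and lowers [u i] by one, and [x] joins the clique found if that has color [i]. The exponent
    is the sum of the target sizes [(u i).+1]. *)
Lemma ramsey_dense_color k n (c : coloring k n) D (u : 'I_k -> nat)
    (S : {set 'I_n}) :
    0 < k -> 0 < D ->
    (forall X : {set 'I_n}, D ^ 2 <= #|X| ->
       exists x i, x \in X /\ #|X| <= D * #|nbrs c X x i|) ->
    D ^ (\sum_i u i + k) <= #|S| ->
  exists i (A : {set 'I_n}), [/\ A \subset S, #|A| = (u i).+1 &
    forall x y, x \in A -> y \in A -> x != y -> c [set x; y] = i].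
Proof.
move=> k_gt0 D_gt0 dense.
have [N] := ubnP (\sum_i u i); elim: N u S => // N IHN u S ltN leS.
have [i /eqP ui0 | u_gt0] := pickP (fun i => u i == 0).
  have /card_gt0P[x Sx]: 0 < #|S|.
    by apply: leq_trans leS; rewrite expn_gt0 D_gt0.
  exists i, [set x]; rewrite sub1set cards1 ui0; split=> // y z.
  by rewrite !inE => /eqP-> /eqP->; rewrite eqxx.
have le_ku: k <= \sum_i u i.
  rewrite -[leqLHS]card_ord -sum1_card; apply: leq_sum => i _.
  by rewrite lt0n u_gt0.
(* As every [u i] is positive, the exponent is at least [2 * k], so [S] has the [D ^ 2] elements
   that [dense] requires. *)
have [|x [i [Sx leX]]] := dense S.
  by apply: leq_trans leS; rewrite leq_pexp2l //; lia.
pose u' j := u j - (j == i).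
have sumu: \sum_j u j = (\sum_j u' j).+1.
  rewrite (bigD1 i) //= [X in _ = X.+1](bigD1 i) //= /u' eqxx.
  rewrite [X in _ = (_ + X).+1](eq_bigr u) => [|j /negPf->]; last exact: subn0.
  by rewrite -addSn subn1 prednK // lt0n u_gt0.
have [||j [A [sA cardA monoA]]] := IHN u' (nbrs c S x i).
- by move: ltN; rewrite sumu.
- by rewrite -(leq_pmul2l D_gt0) -expnS -addSn -sumu (leq_trans leS).
have sAS: A \subset S.
  by apply: subset_trans sA _; apply/subsetP=> y; rewrite inE => /andP[].
have [Dj | ne_ji] := eqVneq j i; last first.
  by exists j, A; rewrite cardA /u' (negPf ne_ji) subn0.
have xA y : y \in A -> y != x /\ c [set x; y] = i.
  by move/(subsetP sA); rewrite inE => /and3P[_ ? /eqP].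
have A'x : x \notin A by apply/negP=> /xA[/eqP].
exists i, (x |: A); split.
- by rewrite subUset sub1set Sx.
- by rewrite cardsU1 A'x cardA Dj /u' eqxx subn1 prednK // lt0n u_gt0.
move=> y z /setU1P[-> | Ay] /setU1P[-> | Az] ne_yz.
- by rewrite eqxx in ne_yz.
- by case: (xA z Az).
- by rewrite setUC; case: (xA y Ay).
- by rewrite -Dj monoA.
Qed.

Lemma dense_color_or_rainbow k n (c : coloring k n) d i (G : sgraph)
    (S : {set 'I_n}) (D := 2 * d ^ 3) :
    0 < d -> #|iter i delete_leaves G| <= d ->
    #|edges G| <= D -> #|G| <= D.+1 -> D ^ 2 <= #|S| ->
  (exists x j, x \in S /\ #|S| <= D * #|nbrs c S x j|) \/
  (exists g, rainbow_on c S [set: G] g).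
Proof.
move=> d_gt0 le_d leE leG leS.
have le_dD: d <= d ^ 3 by rewrite -{1}(expn1 d) leq_pexp2l.
have leD: 2 <= D by rewrite /D; lia.
have [/exists_inP[x Sx /existsP[j le_j]] | ] :=
    boolP [exists x in S, [exists j, #|S| <= D * #|nbrs c S x j|]].
  by left; exists x, j.
move=> /exists_inPn sparse; right.
have S_gt0: 0 < #|S| by apply: leq_trans leS; rewrite expn_gt0; lia.
have n_gt0: 0 < n by rewrite (leq_trans S_gt0) // -[leqRHS]card_ord max_card.
(* The largest integer with [D * m < #|S|]: a color degree that is not dense is at most [m]. *)
pose m := #|S|.-1 %/ D.
have ltm: D * m < #|S| by rewrite -(prednK S_gt0) ltnS mulnC leq_trunc_div.
have lem x j : x \in S -> #|nbrs c S x j| <= m.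
  move=> /sparse/existsPn/(_ j); rewrite -ltnNge => lt_j.
  by rewrite leq_divRL; lia.
apply: (rainbow_iter_delete_leaves (i := i) lem) => //.
  have leG': #|G|.-1 <= D by lia.
  apply: leq_ltn_trans (leq_add leG' (_ : _ <= D.-1 * m)) _.
    by rewrite leq_mul //; lia.
  (* Multiplied by [D], the claim [D + D.-1 * m < #|S|] follows from [D * m <= #|S|.-1],
     [D ^ 2 <= #|S|] and [2 <= D]. *)
  rewrite -(ltn_pmul2l (ltnW leD)).
  have [E DE]: exists E, D = E.+1 by exists D.-1; lia.
  have le1: D.-1 * (D * m) <= D.-1 * #|S|.-1 by rewrite leq_mul //; lia.
  move: le1 leS leD; rewrite -mulnn mulnDr mulnCA DE /=.
  move: S_gt0; case: #|S| => // s _ /=.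
  rewrite [E.+1 * s.+1]mulSn [E * s.+1]mulnS.
  by move: (E.+1 * E.+1) (E.+1 * (E * m)) (E * s); lia.
apply: (rainbow_small lem n_gt0 le_d).
(* Here [d ^ 3 * m] is less than half of [#|S|] because [D * m < #|S|], and [2 * d] is at most half
   because [4 * d <= D ^ 2]. *)
have: D * D <= #|S| by rewrite mulnn.
have ->: D * D = 2 * (d ^ 3 * D) by rewrite mulnA.
have: 2 * d <= d ^ 3 * D by rewrite mulnC leq_mul.
by move: ltm; rewrite /D -mulnA; lia.
Qed.

Theorem theorem1p9 (r s t k a : nat) (G1 : sgraph)
  (hr : r <= 2 * (s - r) ^ 3 - 'C(s - r, 2))
  (ht : 47 <= t)
  (hk : 0 < k)
  (hs : #|G1| = s)
  (ha : 1 <= a)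
  (hGa : is_complete (peel G1 a))
  (hdel : #|edges G1| - #|edges (peel G1 a)| = r) :
  gallai_ramsey k G1 (complete_graph t) <= 2 ^ (k * t) * (s - r) ^ (3 * k * t).
Proof.
rewrite /gallai_ramsey; case: ex_minnP => q _; apply.
set d := s - r in hr *; pose D := 2 * d ^ 3.
have ->: 2 ^ (k * t) * d ^ (3 * k * t) = D ^ (k * t).
  by rewrite expnMn -expnM mulnA.
apply/forallP=> c.
(* If [d = 0], then [hr] forces [r = 0] and hence [s = 0]: the graph [G1] is empty and the empty map
   is a rainbow copy. *)
have [d0 | d_gt0] := posnP d.
  have G0 (v : G1) : False.
    have: 0 < #|G1| by apply/card_gt0P; exists v.
    have r0: r <= 0 by rewrite d0 in hr.
    by move: d0; rewrite /d hs; lia.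
  apply/orP; left; apply/existsP.
  exists [ffun v => False_rect _ (G0 v)]; apply/andP; split.
    by apply/injectiveP=> v; case: (G0 v).
  by apply/forall_inP=> e /edgesP[v]; case: (G0 v).
have le_d: #|iter a.-1 delete_leaves G1| <= d.
  have := edges_iter_delete_leaves G1 a.-1; have := hdel.
  by rewrite /peel /d -hs; lia.
(* This makes the truncated subtraction in [hr] exact, so that [r + 'C(d, 2) <= D]; the bounds on
   the size and order of [G1] follow from it. *)
have leC: 'C(d, 2) <= d ^ 3.
  have: d * d.-1 <= d * d ^ 2.
    by rewrite leq_mul // (leq_trans (leq_pred d)) // -mulnn leq_pmulr.
  by rewrite bin2 -expnS; lia.
have leE: #|edges G1| <= D.
  have: #|edges (peel G1 a)| <= 'C(d, 2).
    apply: (@leq_trans 'C(#|peel G1 a|, 2)); last exact: leq_bin2l.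
    rewrite -cardsT; apply: leq_trans (card_edges_in _).
    by apply/subset_leq_card/subsetP=> e Ee; rewrite inE Ee subsetT.
  by move: hr hdel; rewrite /D; lia.
have leG: #|G1| <= D.+1.
  have: d <= 'C(d, 2).+1.
    by case: (d) d_gt0 => // -[|e] // _; rewrite binS bin1; lia.
  have: s <= d + r by rewrite /d; lia.
  by move: hr leC; rewrite hs /D; clearbody d; lia.
have [// | no_rb] :=
  boolP [exists f : {ffun G1 -> 'I_(D ^ (k * t))}, rainbow_copy c f].
(* Targets [t.-1] in all [k] colors give cliques of order [t] and the exponent
   [k * t.-1 + k = k * t]. *)
have [|||i [A [_ cardA monoA]]] :=
    @ramsey_dense_color k _ c D (fun=> t.-1) [set: _] hk.
- by rewrite muln_gt0 expn_gt0 d_gt0.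
- move=> X leX.
  have [//|[g /rainbow_copyP rb]] :=
    dense_color_or_rainbow c d_gt0 le_d leE leG leX.
  by rewrite rb in no_rb.
- rewrite cardsT card_ord sum_nat_const card_ord [_ + k]addnC -mulnS prednK //.
  exact: leq_trans ht.
by apply: (mono_copyP _ monoA); rewrite cardA prednK //; apply: leq_trans ht.
Qed.
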